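(* Let $\sigma=(\sigma_i)_{i\in\mathbb{N}_0}$ be a consistent stopping family, i.e. a family of $\mathbb{G}$-stopping times with $i\le\sigma_i<\infty$ and $\sigma_i>i\Rightarrow\sigma_i=\sigma_{i+1}$ for all $i\in\mathbb{N}_0$ (a.s.). Fix a window parameter $\kappa\in\mathbb{N}\cup\{\infty\}$ and define $\widehat{\sigma}=(\widehat{\sigma}_i)_{i\in\mathbb{N}_0}$ by $$\widehat{\sigma}_i:=\inf\left\{j\ge i:\ U_j\ge\max_{j\le k\le j+\kappa}\mathbb{E}_{\mathcal{G}_j}[U_{\sigma_k}]\right\}.$$ Then for all $i\in\mathbb{N}_0$, almost surely, $$Y_i^{\sigma}\le\widetilde{Y}_i^{\sigma}\le Y_i^{\widehat{\sigma}}\le Y_i,$$ where $\widetilde{Y}_j^{\sigma}:=\max_{j\le k\le j+\kappa}\mathbb{E}_{\mathcal{G}_j}[U_{\sigma_k}]$.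
   Context: $\mathbb{N}=\{1,2,\dots\}$, $\mathbb{N}_0=\mathbb{N}\cup\{0\}$; $\mathbb{E}_{\mathcal{H}}$ denotes conditional expectation given $\mathcal{H}$. $(\Omega,\mathcal{F},\mathbb{F},\mathbb{P})$ is a filtered probability space with $\mathbb{F}=(\mathcal{F}_t)_{0\le t\le\infty}$ satisfying the usual conditions. $(\tau_i)_{i\in\mathbb{N}_0}$ is a sequence of $\mathbb{F}$-stopping times with, a.s., $\tau_0=0$, $\tau_i<\tau_{i+1}<\infty$ for all $i\in\mathbb{N}_0$, and $\lim_{i\to\infty}\tau_i=\infty$. $T\in(0,\infty)$ is a fixed horizon. $Z=(Z_t)_{0\le t<\infty}$ is a non-negative $\mathbb{F}$-adapted process, càdlàg on $[0,T]$, such that almost surely $Z_t=0$ for all $t>T$. Standing integrability assumption: $\mathbb{E}[\sup_{i\in\mathbb{N}_0}Z_{\tau_i}^{\alpha}]\le B^{\alpha}$ for some $B>0$ and $\alpha>1$. $U_i:=Z_{\tau_i}$, $\mathcal{G}_i:=\mathcal{F}_{\tau_i}$ (the stopping-time $\sigma$-algebra), $\mathbb{G}:=(\mathcal{G}_i)_{i\in\mathbb{N}_0}$, and $\mathcal{N}$ is the set of $\mathbb{N}_0$-valued $\mathbb{G}$-stopping times. For a stopping family $\sigma$, $Y_i^{\sigma}:=\mathbb{E}_{\mathcal{G}_i}[U_{\sigma_i}]$. The Snell envelope is $Y_i:=\operatorname{ess\,sup}_{\mathfrak{n}\in\mathcal{N},\ \mathfrak{n}\ge i}\mathbb{E}_{\mathcal{G}_i}[U_{\mathfrak{n}}]$.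 For $\kappa=\infty$, the maximum over $j\le k\le j+\kappa$ is over all integers $k\ge j$. *)

(* Defs.v *)
From HB Require Import structures.
From mathcomp Require Import all_boot all_order all_algebra.
From mathcomp Require Import all_classical all_reals all_analysis.
From mathcomp Require Import measurable_realfun.

Set Implicit Arguments.
Unset Strict Implicit.
Unset Printing Implicit Defensive.

Import Order.TTheory GRing.Theory Num.Theory.
Import numFieldNormedType.Exports.

Local Open Scope classical_set_scope.
Local Open Scope ring_scope.

(* N_0 \cup {oo}, with None standing for oo. *)
Definition enat := option nat.

Definition le_enat (m n : enat) : bool :=
  match m, n with
  | _, None => true
  | None, Some _ => false
  | Some a, Some b => (a <= b)%N
  end.

(* Infimum of a set of natural numbers, with inf set0 = oo. *)
Definition inf_enat (A : set nat) : enat :=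
  match pselect (exists j, `[< A j >]) with
  | left h => Some (ex_minn h)
  | right _ => None
  end.

(* The greatest element of A.  The default +oo is only returned when A has no
   greatest element. *)
Definition ereal_maximum (R : realType) (A : set (\bar R)) : \bar R :=
  xget +oo%E [set m | A m /\ ubound A m].

(* F t is meaningful for t in [0, +oo] only. *)
Definition filtration (R : realType) d (Omega : measurableType d)
    (F : \bar R -> set (set Omega)) : Prop :=
  (forall t : \bar R, (0 <= t)%E ->
     sigma_algebra setT (F t) /\ F t `<=` measurable) /\
  (forall s t : \bar R, (0 <= s)%E -> (s <= t)%E -> F s `<=` F t).

(* P.-negligible sets are arbitrary subsets of measurable null sets, so that the
   first clause contains the completeness of P. *)
Definition usual_conditions (R : realType) d (Omega : measurableType d)
    (P : probability Omega R) (F : \bar R -> set (set Omega)) : Prop :=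
  (forall N : set Omega, P.-negligible N -> F 0%E N) /\
  (forall t : \bar R, (0 <= t < +oo)%E ->
     \bigcap_(s in [set s : \bar R | (t < s)%E]) F s = F t).

Definition stopping_time (R : realType) d (Omega : measurableType d)
    (F : \bar R -> set (set Omega)) (tau : Omega -> \bar R) : Prop :=
  (forall w, (0 <= tau w)%E) /\
  (forall t : \bar R, (0 <= t)%E -> F t [set w | (tau w <= t)%E]).

(* The clause t = +oo says that A belongs to F_oo. *)
Definition stopped_sigma_algebra (R : realType) d (Omega : measurableType d)
    (F : \bar R -> set (set Omega)) (tau : Omega -> \bar R) : set (set Omega) :=
  [set A | forall t : \bar R, (0 <= t)%E -> F t (A `&` [set w | (tau w <= t)%E])].

Definition sub_measurable d (Omega : measurableType d) d' (E : measurableType d')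
    (G : set (set Omega)) (X : Omega -> E) : Prop :=
  measurable_fun setT (X : g_sigma_algebraType G -> E).

Definition adapted (R : realType) d (Omega : measurableType d)
    (F : \bar R -> set (set Omega)) (Z : R -> Omega -> R) : Prop :=
  forall t : R, 0 <= t -> sub_measurable (F t%:E) (Z t).

Definition cadlag_on (R : realType) (T : R) (z : R -> R) : Prop :=
  (forall t, 0 <= t < T -> z s @[s --> t^'+] --> z t) /\
  (forall t, 0 < t <= T -> cvg (z s @[s --> t^'-])).

(* Z_tau, set to 0 on {tau = +oo}. *)
Definition at_time (R : realType) (Omega : Type) (Z : R -> Omega -> R)
    (tau : Omega -> \bar R) (w : Omega) : R :=
  if tau w is t%:E then Z t w else 0.

(* U_n, set to 0 on {n = oo}. *)
Definition at_enat (R : realType) (Omega : Type) (U : nat -> Omega -> R)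
    (n : Omega -> enat) (w : Omega) : R :=
  if n w is Some k then U k w else 0.

Definition dstopping_time (Omega : Type) (G : nat -> set (set Omega))
    (n : Omega -> enat) : Prop :=
  forall k : nat, G k [set w | le_enat (n w) (Some k)].

Definition stopping_family (R : realType) d (Omega : measurableType d)
    (P : probability Omega R) (G : nat -> set (set Omega))
    (sigma : nat -> Omega -> enat) : Prop :=
  (forall i, dstopping_time G (sigma i)) /\
  (forall i, {ae P, forall w, le_enat (Some i) (sigma i w) /\ sigma i w <> None}).

Definition consistent (R : realType) d (Omega : measurableType d)
    (P : probability Omega R) (sigma : nat -> Omega -> enat) : Prop :=
  forall i, {ae P, forall w,
    le_enat (Some i.+1) (sigma i w) -> sigma i w = sigma i.+1 w}.

(* Y is a version of the conditional expectation of X given the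
   sub-sigma-algebra G; meant for integrable X. *)
Definition is_cond_exp (R : realType) d (Omega : measurableType d)
    (P : probability Omega R) (G : set (set Omega)) (X Y : Omega -> R) : Prop :=
  [/\ sub_measurable G Y,
      P.-integrable setT (EFin \o Y) &
      forall A, G A -> (\int[P]_(w in A) (Y w)%:E = \int[P]_(w in A) (X w)%:E)%E].

(* Y is a version of the essential supremum of the family Phi. *)
Definition is_ess_sup (R : realType) d (Omega : measurableType d)
    (P : probability Omega R) (Phi : set (Omega -> R)) (Y : Omega -> \bar R) :
    Prop :=
  [/\ measurable_fun setT Y,
      forall X, Phi X -> {ae P, forall w, ((X w)%:E <= Y w)%E} &
      forall Y' : Omega -> \bar R, measurable_fun setT Y' ->
        (forall X, Phi X -> {ae P, forall w, ((X w)%:E <= Y' w)%E}) ->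
        {ae P, forall w, (Y w <= Y' w)%E}].

(* All versions of E[U_n | G_i], n ranging over the N_0-valued G-stopping times
   with n >= i. *)
Definition snell_family (R : realType) d (Omega : measurableType d)
    (P : probability Omega R) (G : nat -> set (set Omega)) (U : nat -> Omega -> R)
    (i : nat) : set (Omega -> R) :=
  [set X | exists n : Omega -> nat,
    [/\ dstopping_time G (fun w => Some (n w)),
        {ae P, forall w, (i <= n w)%N} &
        is_cond_exp P (G i) (fun w => U (n w) w) X]].

Definition is_snell_envelope (R : realType) d (Omega : measurableType d)
    (P : probability Omega R) (G : nat -> set (set Omega)) (U : nat -> Omega -> R)
    (Y : nat -> Omega -> \bar R) : Prop :=
  forall i, is_ess_sup P (snell_family P G U i) (Y i).

(* {k | j <= k <= j + kappa}. *)
Definition window (kappa : enat) (j : nat) : set nat :=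
  [set k | (j <= k)%N /\ if kappa is Some m then (k <= j + m)%N else True].

(* The family C stands for versions C j k of E[U_{sigma_k} | G_j]. *)
Definition Ytilde (R : realType) (Omega : Type) (kappa : enat)
    (C : nat -> nat -> Omega -> R) (j : nat) (w : Omega) : \bar R :=
  ereal_maximum [set (C j k w)%:E | k in window kappa j].

Definition sigma_hat (R : realType) (Omega : Type) (kappa : enat)
    (U : nat -> Omega -> R) (C : nat -> nat -> Omega -> R)
    (i : nat) (w : Omega) : enat :=
  inf_enat [set j | (i <= j)%N /\ (Ytilde kappa C j w <= (U j w)%:E)%E].

(* Main.v *)
Require Import Defs.
From HB Require Import structures.
From mathcomp Require Import all_boot all_order all_algebra.
From mathcomp Require Import all_classical all_reals all_analysis.
From mathcomp Require Import measurable_realfun.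

Set Implicit Arguments.
Unset Strict Implicit.
Unset Printing Implicit Defensive.

Import Order.TTheory GRing.Theory Num.Theory.
Import numFieldNormedType.Exports.

Local Open Scope classical_set_scope.
Local Open Scope ring_scope.

(* Write [V_j] for the windowed maximum of the [E_j U_(sigma_k)].  If
   [U_j < V_j], the term [k = j] can be dropped from this maximum: where
   [sigma_j = j] that term is [U_j], and elsewhere consistency makes it the term
   [k = j + 1].  The remaining terms are indexed in the next window, so
   [V_j <= E_j V_(j+1)] there.  Thus [V] is a submartingale up to [hat sigma_i],
   and at that time it is at most [U].  Since [U_k] vanishes once [tau_k > T],
   [E V_n] tends to 0 by domination, and optional stopping gives
   [V_i <= E_i U_(hat sigma_i)].  Conditional inequalities are expressed as
   inequalities between integrals over the events of [G_j]. *)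

(** * Measurability with respect to a sub-sigma-algebra *)

Section sub_sigma_algebra.
Context d (Omega : measurableType d) (H : set (set Omega)).
Hypothesis sH : sigma_algebra setT H.

Lemma g_measurableE (A : set Omega) :
  measurable (A : set (g_sigma_algebraType H)) = H A.
Proof. by rewrite /measurable/= sigma_algebra_id. Qed.

Lemma sigma_algebraT : H setT.
Proof. by rewrite -g_measurableE; exact: measurableT. Qed.

Lemma sigma_algebraI (A B : set Omega) : H A -> H B -> H (A `&` B).
Proof. by rewrite -!g_measurableE; exact: measurableI. Qed.

Lemma sigma_algebraU (A B : set Omega) : H A -> H B -> H (A `|` B).
Proof. by rewrite -!g_measurableE; exact: measurableU. Qed.

Lemma sigma_algebraD (A B : set Omega) : H A -> H B -> H (A `\` B).
Proof. by rewrite -!g_measurableE; exact: measurableD. Qed.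

Lemma sigma_algebra_bigcupT (A : nat -> set Omega) :
  (forall k, H (A k)) -> H (\bigcup_k A k).
Proof. by case: sH => _ _; apply. Qed.

Lemma sub_measurableP d' (E : measurableType d') (X : Omega -> E) :
  sub_measurable H X <-> forall B, measurable B -> H (X @^-1` B).
Proof.
split=> [mX B mB|mX _ B mB].
  by rewrite -g_measurableE -[_ @^-1` _]setTI; exact: mX.
by rewrite setTI g_measurableE; exact: mX.
Qed.

Lemma sub_measurable_measurable d' (E : measurableType d') (X : Omega -> E) :
  H `<=` measurable -> sub_measurable H X -> measurable_fun setT X.
Proof.
by move=> Hm /sub_measurableP mX _ B mB; rewrite setTI; exact/Hm/mX.
Qed.

Lemma sub_measurable_lt (R : realType) (f g : Omega -> \bar R) :
  sub_measurable H f -> sub_measurable H g -> H [set w | (f w < g w)%E].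
Proof.
move=> mf mg; rewrite -g_measurableE -[[set _ | _]]setTI.
exact: measurable_lte.
Qed.

Lemma sub_measurable_le (R : realType) (f g : Omega -> \bar R) :
  sub_measurable H f -> sub_measurable H g -> H [set w | (f w <= g w)%E].
Proof.
move=> mf mg; rewrite -g_measurableE -[[set _ | _]]setTI.
exact: measurable_lee.
Qed.

Lemma sub_measurable_EFin (R : realType) (f : Omega -> R) :
  sub_measurable H f -> sub_measurable H (EFin \o f).
Proof. by move=> mf; exact: measurableT_comp. Qed.

End sub_sigma_algebra.

(** * Sub-sigma-algebras containing all null sets *)

Section complete_sub_sigma_algebra.
Context (R : realType) d (Omega : measurableType d).
Variables (mu : {measure set Omega -> \bar R}) (H : set (set Omega)).
Hypothesis sH : sigma_algebra setT H.
Hypothesis H0 : forall N, mu.-negligible N -> H N.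

(** [A] and [B] differ only inside a null set [N], all of whose subsets belong to [H]; so [B] is [A]
    minus [N] together with a subset of [N]. *)
Lemma sigma_algebra_ae (A B : set Omega) :
  {ae mu, forall w, A w <-> B w} -> H A -> H B.
Proof.
move=> AB HA; pose N := ~` [set w | A w <-> B w].
have HN : H N by exact: H0.
have HBN : H (B `&` N) by apply: H0; exact: negligibleS AB.
have -> : B = (A `\` N) `|` (B `&` N).
  apply/seteqP; split=> w /=.
  - move=> Bw; have [Nw|Nw] := pselect (N w); [by right|left; split=> //].
    by move/contrapT : Nw => /= -[_]; exact.
  - by move=> [[Aw /contrapT/= [+ _]]|[]//]; exact.
by apply: sigma_algebraU => //; exact: sigma_algebraD.
Qed.

Lemma sub_measurable_ae d' (E : measurableType d') (X Y : Omega -> E) :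
  {ae mu, forall w, X w = Y w} -> sub_measurable H X -> sub_measurable H Y.
Proof.
move=> XY /(sub_measurableP sH) mX; apply/(sub_measurableP sH) => B /mX.
by apply: sigma_algebra_ae; apply: filterS XY => w /= ->.
Qed.

End complete_sub_sigma_algebra.

(** * Almost sure inequalities from inequalities between integrals *)

Section integral_comparison.
Context (R : realType) d (Omega : measurableType d).
Variables (mu : {measure set Omega -> \bar R}) (H : set (set Omega)).
Hypotheses (sH : sigma_algebra setT H) (Hm : H `<=` measurable).

Lemma ge0_integral_setID (A B : set Omega) (f : Omega -> \bar R) :
  measurable A -> measurable B -> measurable_fun setT f ->
  (forall w, (0 <= f w)%E) ->
  (\int[mu]_(w in A) f w =
   \int[mu]_(w in A `&` B) f w + \int[mu]_(w in A `\` B) f w)%E.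
Proof.
move=> mA mB mf f0; rewrite -ge0_integral_setU//.
- by rewrite setUIDK.
- exact: measurableI.
- exact: measurableD.
- exact: measurable_funTS.
- by rewrite disj_set2E; apply/eqP/seteqP; split=> // w [[_ Bw] [_]].
Qed.

(** Test the hypothesis on the event where [g < f], which lies in [H]: there [f - g] is positive
    with integral at most 0, so the event is null. *)
Lemma ae_le_of_integral (f g : Omega -> \bar R) :
  sub_measurable H f -> sub_measurable H g ->
  mu.-integrable setT f -> mu.-integrable setT g ->
  (forall A, H A -> (\int[mu]_(w in A) f w <= \int[mu]_(w in A) g w)%E) ->
  {ae mu, forall w, (f w <= g w)%E}.
Proof.
move=> mf mg fi gi fg; pose A := [set w | (g w < f w)%E].
have HA : H A by exact: sub_measurable_lt.
have mA := Hm HA.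
have fA : mu.-integrable A f by exact: integrableS fi.
have gA : mu.-integrable A g by exact: integrableS gi.
have mfg : measurable_fun A (f \- g)%E.
  apply: emeasurable_funB; first exact: measurable_int fA.
  exact: measurable_int gA.
have fg0 : (\int[mu]_(w in A) `|(f \- g) w| = 0)%E.
  apply/eqP; rewrite eq_le integral_ge0// andbT.
  rewrite (eq_integral (f \- g)%E); last first.
    by move=> w; rewrite inE => gf; rewrite gee0_abs//= ltW// sube_gt0.
  rewrite integralB// sube_le0.
  exact: fg.
move/ae_eq_integral_abs : fg0 => /(_ mA mfg); apply: filterS => w /= h.
rewrite leNgt; apply/negP => gf; have := h gf.
move: (f w) (g w) gf {h} => [r||] [s||]//=; rewrite lte_fin => sr [] /eqP.
by rewrite subr_eq0 gt_eqF.
Qed.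

(* On the set where the running maximum of D_0, ..., D_(n-1) is beaten by D_n
   the hypothesis on D_n applies, elsewhere the induction hypothesis does. *)
Lemma integral_ereal_sup_le (D : nat -> Omega -> \bar R) (W : Omega -> \bar R)
    (E : set Omega) :
  (forall k, sub_measurable H (D k)) -> (forall k w, (0 <= D k w)%E) ->
  measurable_fun setT W -> (forall w, (0 <= W w)%E) ->
  (forall k A, H A -> A `<=` E ->
     (\int[mu]_(w in A) D k w <= \int[mu]_(w in A) W w)%E) ->
  forall A, H A -> A `<=` E ->
    (\int[mu]_(w in A) ereal_sup (range (D ^~ w)) <= \int[mu]_(w in A) W w)%E.
Proof.
move=> mD D0 mW W0 DW.
pose M n := iteri n (fun k f w => maxe (f w) (D k w)) (cst 0%E).
have mM n : sub_measurable H (M n).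
  elim: n => [|n ih]; first exact: measurable_cst.
  exact: (measurable_maxe ih (mD n)).
have mM' n := sub_measurable_measurable sH Hm (mM n).
have M0 n w : (0 <= M n w)%E.
  by elim: n => [//|n ih]/=; rewrite le_max ih.
have ndM w : nondecreasing_seq (M ^~ w).
  by apply/nondecreasing_seqP => n /=; rewrite le_max lexx.
have MW n A : H A -> A `<=` E ->
    (\int[mu]_(w in A) M n w <= \int[mu]_(w in A) W w)%E.
  elim: n A => [|n ih] A HA AE /=.
    by rewrite integral0; exact: integral_ge0.
  pose B := [set w | (M n w < D n w)%E].
  have HB : H B by exact: sub_measurable_lt.
  have mA := Hm HA; have mB := Hm HB.
  rewrite (ge0_integral_setID mA mB (mM' n.+1)) ?(ge0_integral_setID mA mB mW)//.
  apply: leeD.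
  - rewrite (eq_integral (D n)); last first.
      by move=> w; rewrite inE => -[_ /ltW MD]; apply/max_idPr.
    by apply: DW; [exact: sigma_algebraI|exact: subset_trans AE].
  - rewrite (eq_integral (M n)); last first.
      by move=> w; rewrite inE => -[_ /negP]; rewrite -leNgt => MD; apply/max_idPl.
    by apply: ih; [exact: sigma_algebraD|exact: subset_trans AE].
move=> A HA AE; have mA := Hm HA.
(* Starting the running maximum at 0 does not change the supremum, because every [D k] is
   nonnegative. *)
have supE w : ereal_sup (range (D ^~ w)) = limn (M ^~ w).
  have /cvg_lim -> // := ereal_nondecreasing_cvgn (ndM w).
  apply/eqP; rewrite eq_le; apply/andP; split; apply: ge_ereal_sup => _ [n _ <-].
    apply: (@le_trans _ _ (M n.+1 w)); first by rewrite /= le_max lexx orbT.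
    by apply: ereal_sup_ubound; exists n.+1.
  elim: n => [|n ih] /=.
    by apply: (le_trans (D0 0%N w)); apply: ereal_sup_ubound; exists 0%N.
  by rewrite ge_max ih/=; apply: ereal_sup_ubound; exists n.
under eq_integral do rewrite supE.
rewrite monotone_convergence//; last by move=> n; exact: measurable_funTS.
apply: lime_le; last by apply: nearW => n; exact: MW.
apply: ereal_nondecreasing_is_cvgn => m n mn; apply: ge0_le_integral => //.
- exact: measurable_funTS.
- exact: measurable_funTS.
- by move=> w _; exact: ndM.
Qed.

End integral_comparison.

(** * Suprema of sequences, first indices and attained maxima *)

Lemma measurable_ereal_sup_range (R : realType) d (T : measurableType d)
    (D : set T) (f : nat -> T -> \bar R) :
  (forall n, measurable_fun D (f n)) ->
  measurable_fun D (fun x => ereal_sup (range (f ^~ x))).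
Proof.
move=> mf; have -> : (fun x => ereal_sup (range (f ^~ x))) =
    (fun x => esups (f ^~ x) 0%N).
  apply/funext => x; rewrite /esups /=; congr ereal_sup.
  by apply/seteqP; split=> _ [n _ <-]; exists n.
exact: measurable_fun_esups.
Qed.

Lemma inf_enat_leP (A : set nat) (k : nat) :
  le_enat (inf_enat A) (Some k) <-> exists2 j, A j & (j <= k)%N.
Proof.
rewrite /inf_enat; case: pselect => [h|nA].
  case: ex_minnP => m /asboolP Am Amin.
  split=> [mk|[j Aj jk]]; first by exists m.
  by apply: leq_trans jk; apply: Amin; exact/asboolP.
split=> // -[j Aj _]; exfalso; apply: nA.
by exists j; exact/asboolP.
Qed.

Lemma inf_enat_SomeP (A : set nat) (k : nat) :
  A k -> (forall j, (j < k)%N -> ~ A j) -> inf_enat A = Some k.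
Proof.
move=> Ak kmin; have /inf_enat_leP : exists2 j, A j & (j <= k)%N by exists k.
have : forall j, inf_enat A = Some j -> A j.
  move=> j; rewrite /inf_enat; case: pselect => // h.
  by case: ex_minnP => m /asboolP Am _ [<-].
case: (inf_enat A) => // j /(_ _ erefl) Aj /=.
by rewrite leq_eqVlt => /predU1P[->//|/kmin].
Qed.

Lemma ereal_maximumE (R : realType) (A : set (\bar R)) (m : \bar R) :
  A m -> ubound A m -> ereal_maximum A = m.
Proof.
move=> Am mub; apply: xget_unique => // x [Ax xub].
by apply/eqP; rewrite eq_le mub// xub.
Qed.

(* Versions of conditional expectations of [U] are only almost surely
   nonnegative; cutting them off at 0, and setting them to 0 outside the window,
   gives a supremum over all of [nat] to which monotone convergence applies. *)
Definition pos_on (R : realType) (K : set nat) (c : nat -> R) (k : nat) :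
    \bar R :=
  if `[< K k >] then (Num.max (c k) 0)%:E else 0%E.

Definition pos_sup (R : realType) (K : set nat) (c : nat -> R) : \bar R :=
  ereal_sup (range (pos_on K c)).

Lemma pos_on_ge0 (R : realType) (K : set nat) (c : nat -> R) k :
  (0 <= pos_on K c k)%E.
Proof.
by rewrite /pos_on; case: ifP => // _; rewrite lee_fin le_max lexx orbT.
Qed.

Lemma pos_sup_ge0 (R : realType) (K : set nat) (c : nat -> R) :
  (0 <= pos_sup K c)%E.
Proof.
apply: (le_trans (pos_on_ge0 K c 0%N)).
by apply: ereal_sup_ubound; exists 0%N.
Qed.

Lemma pos_sup_ge (R : realType) (K : set nat) (c : nat -> R) k :
  K k -> ((c k)%:E <= pos_sup K c)%E.
Proof.
move=> Kk; apply: (@le_trans _ _ (pos_on K c k)).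
  by rewrite /pos_on asboolT// lee_fin le_max lexx.
by apply: ereal_sup_ubound; exists k.
Qed.

Lemma pos_sup_le (R : realType) (K : set nat) (c : nat -> R) (x : \bar R) :
  (0 <= x)%E -> (forall k, K k -> ((c k)%:E <= x)%E) -> (pos_sup K c <= x)%E.
Proof.
move=> x0 cx; apply: ge_ereal_sup => _ [k _ <-]; rewrite /pos_on.
by case: asboolP => // Kk; rewrite EFin_max ge_max cx.
Qed.

(** If some term is positive, all terms from some index on lie below it, so finitely many indices
    compete and a greatest element exists; if no term is positive, all are 0. The greatest element
    then equals the supremum, and the cut-off at 0 changes nothing. *)
Lemma ereal_maximum_pos_sup (R : realType) (K : set nat) (c : nat -> R) :
  (exists k, K k) -> (forall k, K k -> 0 <= c k) ->
  (forall e, 0 < e -> exists n, forall k, K k -> (n <= k)%N -> c k < e) ->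
  ereal_maximum [set (c k)%:E | k in K] = pos_sup K c.
Proof.
move=> [k0 Kk0] c0 csmall.
have [k1 Kk1 k1max] : exists2 k1, K k1 & forall k, K k -> c k <= c k1.
  have [[k2 Kk2 ck2]|noc] := pselect (exists2 k, K k & 0 < c k); last first.
    exists k0 => // k Kk; apply: (@le_trans _ _ 0); last exact: c0.
    by rewrite leNgt; apply/negP => ck; apply: noc; exists k.
  have [n nsmall] := csmall _ ck2.
  have k2n : (k2 < n)%N.
    by rewrite ltnNge; apply/negP => /(nsmall _ Kk2); rewrite ltxx.
  case: (@arg_maxP _ _ _ (Ordinal k2n) (fun i : 'I_n => `[< K i >])
    (fun i => c i)) => [|i /asboolP Ki imax]; first exact/asboolP.
  exists i => // k Kk; have [nk|kn] := leqP n k.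
    apply: (le_trans (ltW (nsmall _ Kk nk))).
    by apply: (imax (Ordinal k2n)); exact/asboolP.
  by apply: (imax (Ordinal kn)); exact/asboolP.
rewrite (@ereal_maximumE _ _ (c k1)%:E); last first.
- by move=> _ [k Kk <-]; rewrite lee_fin k1max.
- by exists k1.
apply/eqP; rewrite eq_le pos_sup_ge//=; apply: pos_sup_le => [|k Kk].
  by rewrite lee_fin c0.
by rewrite lee_fin k1max.
Qed.

(** * Discrete stopping times and stopped sequences *)

Section optional_times.
Context (R : realType) d (Omega : measurableType d).
Variable (G : nat -> set (set Omega)).
Hypothesis sG : forall j, sigma_algebra setT (G j).
Hypothesis Gm : forall j, G j `<=` measurable.
Hypothesis GS : forall j, G j `<=` G j.+1.

Lemma filtration_le j k : (j <= k)%N -> G j `<=` G k.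
Proof.
move=> /subnK <-; elim: (k - j)%N => [|n ih]; first by rewrite add0n.
by rewrite addSn => A /ih /GS.
Qed.

Lemma dstopping_time_eq (n : Omega -> enat) k :
  dstopping_time G n -> G k [set w | n w = Some k].
Proof.
move=> nG; case: k => [|k].
  rewrite (_ : [set _ | _] = [set w | le_enat (n w) (Some 0%N)]); first exact: nG.
  apply/seteqP; split=> w /=; first by move=> ->.
  by case: (n w) => //= m; rewrite leqn0 => /eqP ->.
rewrite (_ : [set _ | _] = [set w | le_enat (n w) (Some k.+1)] `\`
                           [set w | le_enat (n w) (Some k)]).
  by apply: sigma_algebraD => //; exact/GS/nG.
apply/seteqP; split=> w /=; first by move=> -> /=; rewrite leqnn ltnn.
case: (n w) => [m|[]//] /= [mk /negP]; rewrite -ltnNge => km.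
by congr Some; apply/eqP; rewrite eqn_leq mk.
Qed.

Variable U : nat -> Omega -> R.
Hypothesis U0 : forall j w, 0 <= U j w.
Hypothesis mU : forall j, sub_measurable (G j) (U j).

Lemma at_enat_ge0 (n : Omega -> enat) w : 0 <= at_enat U n w.
Proof. by rewrite /at_enat; case: (n w). Qed.

(** Cut the space into the countably many events on which [n] has a given finite value, and the
    event where [n] is infinite; on the latter the stopped value is 0. *)
Lemma measurable_at_enat (n : Omega -> enat) :
  dstopping_time G n -> measurable_fun setT (at_enat U n).
Proof.
move=> nG; have nk k : measurable [set w | n w = Some k].
  exact/Gm/dstopping_time_eq.
pose A k := [set w | n w = Some k].
have -> : [set: Omega] = (\bigcup_k A k) `|` ~` (\bigcup_k A k) by rewrite setUv.
have mA : measurable (\bigcup_k A k) by exact: bigcupT_measurable.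
apply/measurable_funU => //; first exact: measurableC.
split.
  apply/measurable_fun_bigcup => // k; apply: (eq_measurable_fun (U k)).
    by move=> w; rewrite inE /A/= /at_enat => ->.
  by apply: measurable_funTS; exact: (sub_measurable_measurable (sG k) (@Gm k)).
apply: (eq_measurable_fun (cst (0 : R))); last exact: measurable_cst.
move=> w; rewrite inE /A /at_enat => nA.
by case nw : (n w) => [k|//]; exfalso; apply: nA; exists k.
Qed.

End optional_times.

(** * Improvement of a consistent family in discrete time *)

Section consistent_family.
Context (R : realType) d (Omega : measurableType d) (P : probability Omega R).
Variable G : nat -> set (set Omega).
Hypothesis sG : forall j, sigma_algebra setT (G j).
Hypothesis Gm : forall j, G j `<=` measurable.
Hypothesis GS : forall j, G j `<=` G j.+1.
Hypothesis G0 : forall j N, P.-negligible N -> G j N.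

Lemma cond_exp_ge0 j (X Y : Omega -> R) :
  (forall w, 0 <= X w) -> is_cond_exp P (G j) X Y ->
  {ae P, forall w, 0 <= Y w}.
Proof.
move=> X0 [mY iY XY].
have : {ae P, forall w, (cst 0%E w <= (EFin \o Y) w)%E}.
  apply: (ae_le_of_integral (sG j) (@Gm j)) => //.
  - exact: measurable_cst.
  - exact: sub_measurable_EFin.
  - exact: integrable0.
  - move=> A GA; rewrite integral0 /= XY//; apply: integral_ge0 => w _.
    by rewrite lee_fin.
by apply: filterS => w /=; rewrite lee_fin.
Qed.

Lemma cond_exp_unique j (X Y Y' : Omega -> R) :
  is_cond_exp P (G j) X Y -> is_cond_exp P (G j) X Y' ->
  {ae P, forall w, Y w = Y' w}.
Proof.
move=> [mY iY XY] [mY' iY' XY'].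
have YY' : {ae P, forall w, ((EFin \o Y) w <= (EFin \o Y') w)%E}.
  apply: (ae_le_of_integral (sG j) (@Gm j)) => //.
  - exact: sub_measurable_EFin.
  - exact: sub_measurable_EFin.
  - by move=> A GA /=; rewrite XY// XY'.
have Y'Y : {ae P, forall w, ((EFin \o Y') w <= (EFin \o Y) w)%E}.
  apply: (ae_le_of_integral (sG j) (@Gm j)) => //.
  - exact: sub_measurable_EFin.
  - exact: sub_measurable_EFin.
  - by move=> A GA /=; rewrite XY// XY'.
apply: filterS2 YY' Y'Y => w /=; rewrite !lee_fin => ? ?.
by apply/eqP; rewrite eq_le; apply/andP.
Qed.

Variable U : nat -> Omega -> R.
Hypothesis U0 : forall j w, 0 <= U j w.
Hypothesis mU : forall j, sub_measurable (G j) (U j).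

(** The common dominating function: [S n] bounds almost surely every payoff stopped at or after [n],
    and its integral tends to 0. *)
Let S n w := esups (fun m => (U m w)%:E) n.

Hypothesis US : (\int[P]_w ereal_sup (range (fun m => (U m w)%:E)) < +oo)%E.
(** [E n] abstracts the event that the horizon has been passed at the [n]-th time. It makes the
    payoffs vanish eventually and forces the improved rule to stop. *)
Variable E : nat -> set Omega.
Hypothesis GE : forall n, G n (E n).
Hypothesis EU : {ae P, forall w, forall n m, E n w -> (n <= m)%N -> U m w = 0}.
Hypothesis Eev : {ae P, forall w, forall i, exists2 n, (i <= n)%N & E n w}.

Let Uev : {ae P, forall w, exists n, forall m, (n <= m)%N -> U m w = 0}.
Proof.
by apply: filterS2 EU Eev => w EUw /(_ 0%N)[n _ En]; exists n => m; exact: EUw.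
Qed.

Let mUT j : measurable_fun setT (U j).
Proof. exact: (sub_measurable_measurable (sG j) (@Gm j)). Qed.

Let mS n : measurable_fun setT (S n).
Proof. by apply: measurable_fun_esups => m; exact/measurable_EFinP. Qed.

Let US_ge n m w : (n <= m)%N -> ((U m w)%:E <= S n w)%E.
Proof. by move=> nm; apply: ereal_sup_ubound; exists m. Qed.

Let S_ge0 n w : (0 <= S n w)%E.
Proof. by apply: (@le_trans _ _ (U n w)%:E); [rewrite lee_fin|exact: US_ge]. Qed.

Let S_le n m w : (n <= m)%N -> (S m w <= S n w)%E.
Proof. exact: nonincreasing_esups. Qed.

Let iS : P.-integrable setT (S 0%N).
Proof.
apply/integrableP; split=> //; apply: le_lt_trans US.
apply: ge0_le_integral => //.
- exact: measurableT_comp.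
- by apply: measurable_ereal_sup_range => m; exact/measurable_EFinP.
- move=> w _; rewrite gee0_abs//; apply: ge_ereal_sup => _ [m _ <-].
  by apply: ereal_sup_ubound; exists m.
Qed.

(** Almost every path of [U] is eventually 0, hence so is [S n]; domination is by [S 0]. *)
Let intS_cvg : (\int[P]_w S n w)%E @[n --> \oo] --> 0%E.
Proof.
have [||||_ _] := @dominated_convergence _ _ _ P setT measurableT S (cst 0%E)
    (S 0%N) mS.
- exact: measurable_cst.
- apply: filterS Uev => w [n Un] _; apply: cvg_near_cst; near=> k.
  apply/eqP; rewrite eq_le S_ge0 andbT; apply: ge_ereal_sup => _ [m /= km <-].
  rewrite lee_fin Un//; apply: leq_trans km; near: k; exact: nbhs_infty_ge.
- exact: iS.
- by apply: aeW => w n _; rewrite gee0_abs// S_le.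
by rewrite integral0.
Unshelve. all: by end_near. Qed.

Let intS_lty n : (\int[P]_w S n w < +oo)%E.
Proof.
apply: le_lt_trans (integrable_lty measurableT iS).
by apply: ge0_le_integral => // w _; exact: S_le.
Qed.

Let ge0_integrable (f : Omega -> \bar R) : measurable_fun setT f ->
  (forall w, (0 <= f w)%E) -> (\int[P]_w f w < +oo)%E -> P.-integrable setT f.
Proof.
move=> mf f0 foo; apply/integrableP; split=> //.
by under eq_integral do rewrite gee0_abs//.
Qed.

Variable sigma : nat -> Omega -> enat.
Hypothesis hsigma : stopping_family P G sigma.
Hypothesis hconsistent : consistent P sigma.
Variable kappa : enat.
Hypothesis hkappa : le_enat (Some 1%N) kappa.
Variable C : nat -> nat -> Omega -> R.
Hypothesis hC : forall j k, (j <= k)%N ->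
  is_cond_exp P (G j) (at_enat U (sigma k)) (C j k).

Let X k := at_enat U (sigma k).

Let mX k : measurable_fun setT (EFin \o X k).
Proof.
apply/measurable_EFinP; apply: (measurable_at_enat sG Gm GS) => //.
by case: hsigma.
Qed.

Let X0 k w : (0 <= (X k w)%:E)%E.
Proof. by rewrite lee_fin at_enat_ge0. Qed.

Let XS n k : (n <= k)%N -> {ae P, forall w, ((X k w)%:E <= S n w)%E}.
Proof.
move=> nk; case: hsigma => _ /(_ k); apply: filterS => w.
rewrite /X /at_enat; case: (sigma k w) => [l /= [kl _]|[]//].
by apply: US_ge; exact: leq_trans nk kl.
Qed.

Let C0 : {ae P, forall w, forall j k, (j <= k)%N -> 0 <= C j k w}.
Proof.
apply: ae_foralln => j; apply: ae_foralln => k.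
have [jk|kj] := leqP j k; last by apply: aeW.
apply: filterS (cond_exp_ge0 (at_enat_ge0 U0 _) (hC jk)) => w //.
Qed.

Let mpos K j k : (forall k, K k -> (j <= k)%N) ->
  sub_measurable (G j) (fun w => pos_on K (C j ^~ w) k).
Proof.
move=> Kj; rewrite /pos_on; case: asboolP => [/Kj /hC [mC _ _]|_].
  apply: sub_measurable_EFin.
  exact: (measurable_maxr mC (measurable_cst (0 : R))).
exact: measurable_cst.
Qed.

(** The cut-off alters [C j k] only on a null set, so the defining property of conditional
    expectation survives it. *)
Let int_pos K j k A : K k -> (j <= k)%N -> G j A ->
  (\int[P]_(w in A) pos_on K (C j ^~ w) k = \int[P]_(w in A) (X k w)%:E)%E.
Proof.
move=> Kk jk GA; have [mC _ <- //] := hC jk.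
have mA := Gm GA.
have mCT := sub_measurable_measurable (sG j) (@Gm j) mC.
have posE w : pos_on K (C j ^~ w) k = (Num.max (C j k w) 0)%:E.
  by rewrite /pos_on asboolT.
under eq_integral do rewrite posE.
apply: ae_eq_integral => //.
- apply/measurable_EFinP; apply: measurable_funTS; exact: measurable_maxr.
- by apply/measurable_EFinP; exact: measurable_funTS.
by apply: filterS C0 => w /(_ _ _ jk) Cw _; congr EFin; exact/max_idPl.
Qed.

Let mpos_sup K j : (forall k, K k -> (j <= k)%N) ->
  sub_measurable (G j) (fun w => pos_sup K (C j ^~ w)).
Proof.
by move=> Kj; apply: measurable_ereal_sup_range => k; exact: mpos.
Qed.

(** Integral form of the bound of the supremum of the [E_j X_k], [k >= n], by [E_j S_n]. It is used
    both for windows and for tails. *)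
Let int_pos_sup_le K j n A : (forall k, K k -> (n <= k)%N) -> (j <= n)%N ->
  G j A ->
  (\int[P]_(w in A) pos_sup K (C j ^~ w) <= \int[P]_(w in A) S n w)%E.
Proof.
move=> Kn jn GA; have Kj k : K k -> (j <= k)%N by move=> /Kn; exact: leq_trans.
apply: (@integral_ereal_sup_le _ _ _ P _ (sG j) (@Gm j) _ _ setT) => //.
- by move=> k; exact: mpos.
- by move=> k w; exact: pos_on_ge0.
move=> k B GB _; have [Kk|nK] := pselect (K k); last first.
  rewrite (eq_integral (cst 0%E)) ?integral0 ?integral_ge0//.
  by move=> w _; rewrite /pos_on asboolF.
rewrite int_pos//; last exact: Kj.
have mB := Gm GB.
apply: ae_ge0_le_integral => //.
- exact: measurable_funTS (mX k).
- exact: measurable_funTS (mS n).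
by apply: filterS (XS (Kn _ Kk)) => w.
Qed.


(** * The windowed maximum [W], a measurable version of [Ytilde] *)

Let W j w := pos_sup (window kappa j) (C j ^~ w).

Let window_ge j k : window kappa j k -> (j <= k)%N.
Proof. by case. Qed.

Let window_refl j : window kappa j j.
Proof. by split=> //; case: kappa => // m; exact: leq_addr. Qed.

(** This is where [kappa >= 1] enters. *)
Let window_succ j : window kappa j j.+1.
Proof.
by split=> //; case: kappa hkappa => //= m m0; rewrite -addn1 leq_add2l.
Qed.

(** The right end of a finite window moves up with [j], so only the index [j] is lost. *)
Let window_step j k : window kappa j k -> (j < k)%N -> window kappa j.+1 k.
Proof.
move=> [jk wk] jk1; split=> //; case: kappa wk => // m.
by move=> /leq_trans; apply; rewrite leq_add2r.
Qed.

Let mW j : sub_measurable (G j) (W j).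
Proof. exact: mpos_sup (@window_ge j). Qed.

Let mWT j : measurable_fun setT (W j).
Proof. exact: (sub_measurable_measurable (sG j) (@Gm j) (@mW j)). Qed.

Let W0 j w : (0 <= W j w)%E.
Proof. exact: pos_sup_ge0. Qed.

Let intW_le j A : G j A -> (\int[P]_(w in A) W j w <= \int[P]_(w in A) S j w)%E.
Proof. by apply: int_pos_sup_le => // k /window_ge. Qed.

Let iW j : P.-integrable setT (W j).
Proof.
apply: ge0_integrable => //; apply: le_lt_trans (intS_lty j).
exact/intW_le/(sigma_algebraT (sG j)).
Qed.

(* The integral of [sup_{k >= n} C j k] is at most that of [S n], which tends to
   0; hence the maximum over an infinite window is attained almost surely. *)
Let C_small j : {ae P, forall w, forall e, 0 < e ->
  exists n, forall k, (n <= k)%N -> (j <= k)%N -> C j k w < e}.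
Proof.
pose Q n w := pos_sup [set k | (j + n <= k)%N] (C j ^~ w).
have mQ n : measurable_fun setT (Q n).
  apply: (sub_measurable_measurable (sG j) (@Gm j)); apply: mpos_sup => k /=.
  exact/leq_trans/leq_addr.
have Q0 n w : (0 <= Q n w)%E by exact: pos_sup_ge0.
pose q w := einfs (Q ^~ w) 0%N.
have mq : measurable_fun setT q by exact: measurable_fun_einfs.
have q0 w : (0 <= q w)%E by apply: le_ereal_inf_tmp => _ [n _ <-].
have qQ n w : (q w <= Q n w)%E by apply: ereal_inf_lbound; exists n.
have : (\int[P]_w `|q w| = 0)%E.
  apply/eqP; rewrite eq_le integral_ge0// andbT.
  under eq_integral do rewrite gee0_abs//.
  (* [Q (n - j)] is the supremum over [k >= n]; its integral dominates that of [q] and is at most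
     that of [S n], which tends to 0. *)
  apply: (cvge_to_ge intS_cvg); exists j => // n /= jn.
  rewrite -(subnKC jn).
  apply: (@le_trans _ _ (\int[P]_w Q (n - j)%N w)%E).
    exact: ge0_le_integral.
  by apply: int_pos_sup_le => //; [exact: leq_addr|exact: (sigma_algebraT (sG j))].
move/ae_eq_integral_abs => /(_ measurableT mq); apply: filterS => w /= /(_ I) qw e e0.
have : (q w < e%:E)%E by rewrite qw lte_fin.
move=> /ereal_inf_lt[_ [n _ <-] Qe]; exists (j + n)%N => k nk jk.
by rewrite -lte_fin; apply: le_lt_trans Qe; exact: pos_sup_ge.
Qed.

(** By [C_small] the maximum is attained almost surely, so the default value of [ereal_maximum]
    occurs only on a null set. *)
Let Ytilde_ae : {ae P, forall w, forall j, W j w = Ytilde kappa C j w}.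
Proof.
apply: ae_foralln => j; apply: filterS2 C0 (C_small j) => w C0w Csw.
rewrite /Ytilde ereal_maximum_pos_sup//.
- by exists j.
- by move=> k /window_ge; exact: C0w.
- by move=> e /Csw[n nC]; exists n => k /window_ge jk nk; exact: nC.
Qed.

(** Measurability is transferred from [W j] across a null set, which uses that [G j] contains the
    null sets. *)
Let mYtilde j : sub_measurable (G j) (Ytilde kappa C j).
Proof.
apply: (sub_measurable_ae (sG j) (@G0 j) _ (@mW j)).
by apply: filterS Ytilde_ae => w.
Qed.

(* [C j j] is [U j] where [sigma j = j] and [C j j.+1] elsewhere. *)
Let C_diag j : {ae P, forall w,
  ((C j j w)%:E <= maxe (U j w)%:E (C j j.+1 w)%:E)%E}.
Proof.
pose K := [set k | (j <= k)%N].
have Kj k : K k -> (j <= k)%N by [].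
have Kj0 : K j by rewrite /K/=.
have Kj1 : K j.+1 by rewrite /K/=.
pose f := fun w => pos_on K (C j ^~ w) j.
pose f' := fun w => pos_on K (C j ^~ w) j.+1.
pose g := fun w => maxe (U j w)%:E (f' w).
have mf : sub_measurable (G j) f by exact: mpos.
have mf' : sub_measurable (G j) f' by exact: mpos.
have mg : sub_measurable (G j) g.
  exact: (measurable_maxe (sub_measurable_EFin (@mU j)) mf').
have mfT := sub_measurable_measurable (sG j) (@Gm j) mf.
have mf'T := sub_measurable_measurable (sG j) (@Gm j) mf'.
have mgT := sub_measurable_measurable (sG j) (@Gm j) mg.
have f0 w : (0 <= f w)%E by exact: pos_on_ge0.
have f'0 w : (0 <= f' w)%E by exact: pos_on_ge0.
have g0 w : (0 <= g w)%E by rewrite le_max f'0 orbT.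
have mUE : measurable_fun setT (EFin \o U j) by exact/measurable_EFinP.
have UE0 w : (0 <= (U j w)%:E)%E by rewrite lee_fin.
have XT k : (j <= k)%N -> (\int[P]_w (X k w)%:E <= \int[P]_w S j w)%E.
  move=> jk; apply: ae_ge0_le_integral => //; first exact: mX.
  by apply: filterS (XS jk) => w.
have GT := sigma_algebraT (sG j).
have if_ : P.-integrable setT f.
  apply: ge0_integrable => //; rewrite int_pos//.
  exact: (le_lt_trans (XT _ (leqnn j)) (intS_lty j)).
have ig : P.-integrable setT g.
  apply: ge0_integrable => //.
  apply: (@le_lt_trans _ _ (\int[P]_w ((U j w)%:E + f' w))%E).
    apply: ge0_le_integral => //; first exact: emeasurable_funD.
    by move=> w _; rewrite ge_max leeDl//= leeDr.
  rewrite ge0_integralD//; apply: lte_add_pinfty.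
    apply: le_lt_trans (intS_lty j); apply: ge0_le_integral => // w _.
    exact: US_ge.
  rewrite int_pos//; exact: (le_lt_trans (XT _ (leqnSn j)) (intS_lty j)).
have : {ae P, forall w, (f w <= g w)%E}.
  apply: (ae_le_of_integral (sG j) (@Gm j)) => // A GA; have mA := Gm GA.
  (* [f] integrates like [X j]. On [B] this is [U j]; off [B], consistency makes it [X j.+1], which
     integrates like [f']. *)
  rewrite int_pos//; pose B := [set w | sigma j w = Some j].
  have GB : G j B by apply: dstopping_time_eq => //; case: hsigma.
  have mB := Gm GB.
  rewrite (ge0_integral_setID P mA mB (mX j)); last exact: X0.
  rewrite (ge0_integral_setID P mA mB mgT)//.
  have mAB : measurable (A `&` B) by exact: measurableI.
  have mADB : measurable (A `\` B) by exact: measurableD.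
  apply: leeD.
    apply: ge0_le_integral => //.
    - by move=> w _; exact: X0.
    - exact: (measurable_funTS (mX j)).
    - exact: (measurable_funTS mgT).
    by move=> w [_ Bw]; rewrite /= /X /at_enat Bw le_max lexx.
  apply: (@le_trans _ _ (\int[P]_(w in A `\` B) (X j.+1 w)%:E)%E).
    apply: ae_ge0_le_integral => //.
    - by move=> w _; exact: X0.
    - exact: (measurable_funTS (mX j)).
    - exact: (measurable_funTS (mX j.+1)).
    case: hsigma => _ /(_ j) sj.
    apply: filterS2 sj (hconsistent j) => w [js _] sw.
    move=> [_ /= nB]; rewrite /X /at_enat -sw//.
    move: js nB; rewrite /B/=; case: (sigma j w) => //= m.
    by rewrite leq_eqVlt => /predU1P[->|//].
  rewrite -(@int_pos K j)//; last exact: sigma_algebraD.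
  apply: ge0_le_integral => //.
  - by move=> w _; exact: f'0.
  - exact: (measurable_funTS mf'T).
  - exact: (measurable_funTS mgT).
  by move=> w _; rewrite le_max lexx orbT.
move=> fg; apply: filterS2 C0 fg => w C0w; rewrite /f /g /f' /pos_on !asboolT//.
by rewrite (max_idPl (C0w _ _ (leqnn j))) (max_idPl (C0w _ _ (leqnSn j))).
Qed.

Let W_le j : {ae P, forall w, (W j w <=
  maxe (U j w)%:E (pos_sup (window kappa j `&` [set k | (j < k)%N]) (C j ^~ w)))%E}.
Proof.
apply: filterS (C_diag j) => w Cw; apply: pos_sup_le => [|k wk].
  by rewrite le_max lee_fin U0.
have [jk|kj] := ltnP j k; first by rewrite le_max pos_sup_ge ?orbT.
have -> : k = j by apply/eqP; rewrite eqn_leq kj (window_ge wk).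
apply: (le_trans Cw); rewrite ge_max !le_max lexx/= pos_sup_ge ?orbT//.
by split=> /=; [exact: window_succ|exact: ltnSn].
Qed.


(** * The improved stopping rule and optional stopping *)

Let Hs j := [set w | (Ytilde kappa C j w <= (U j w)%:E)%E].

Let GHs j : G j (Hs j).
Proof.
exact: (sub_measurable_le (sG j) (@mYtilde j) (sub_measurable_EFin (@mU j))).
Qed.

(** The submartingale step: before stopping, [W_le] removes the index [j] from the window, and every
    remaining index belongs to the window of [j.+1]. *)
Let intW_step j A : G j A -> A `<=` ~` Hs j ->
  (\int[P]_(w in A) W j w <= \int[P]_(w in A) W j.+1 w)%E.
Proof.
move=> GA AH; have mA := Gm GA.
pose K := window kappa j `&` [set k | (j < k)%N].
have Kj k : K k -> (j <= k)%N by case=> /window_ge.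
have mK : sub_measurable (G j) (fun w => pos_sup K (C j ^~ w)) by exact: mpos_sup.
have mKT := sub_measurable_measurable (sG j) (@Gm j) mK.
apply: (@le_trans _ _ (\int[P]_(w in A) pos_sup K (C j ^~ w))%E).
  apply: ae_ge0_le_integral => //.
  - exact: (measurable_funTS (mWT j)).
  - by move=> w _; exact: pos_sup_ge0.
  - exact: (measurable_funTS mKT).
  apply: filterS2 (W_le j) Ytilde_ae => w Ww /(_ j) YW Aw; apply: (le_trans Ww).
  rewrite ge_max lexx andbT leNgt; apply/negP => KU.
  by apply: (AH _ Aw); rewrite /Hs /= -YW (le_trans Ww)// ge_max lexx ltW.
apply: (@integral_ereal_sup_le _ _ _ P _ (sG j) (@Gm j) _ _ setT) => //.
- by move=> k; exact: mpos.
- by move=> k w; exact: pos_on_ge0.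
move=> k B GB _; have [Kk|nK] := pselect (K k); last first.
  rewrite (eq_integral (cst 0%E)) ?integral0 ?integral_ge0//.
  by move=> w _; rewrite /pos_on asboolF.
have [wk jk] := Kk; have wk' := window_step wk jk.
(* Tower property: over [B] in [G j], both [C j k] and [C j.+1 k] integrate like [X k]. *)
rewrite (int_pos Kk (Kj _ Kk) GB) -(int_pos wk' jk (GS GB)).
have mB := Gm GB; apply: ge0_le_integral => //.
- by move=> w _; exact: pos_on_ge0.
- apply: measurable_funTS.
  apply: (sub_measurable_measurable (sG j.+1) (@Gm j.+1)).
  exact: (mpos _ (@window_ge j.+1)).
- exact: (measurable_funTS (mWT j.+1)).
- by move=> w _; apply: ereal_sup_ubound; exists k.
Qed.

(** On [E j] the tail supremum [S j] vanishes almost surely, and over this event of [G j] the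
    integral of [W j] is at most that of [S j]. *)
Let W_eq0 : {ae P, forall w, forall j, E j w -> W j w = 0%E}.
Proof.
apply: ae_foralln => j; have mE := Gm (@GE j).
have : (\int[P]_(w in E j) `|W j w| = 0)%E.
  apply/eqP; rewrite eq_le integral_ge0// andbT.
  under eq_integral do rewrite gee0_abs//.
  apply: (le_trans (intW_le (@GE j))).
  rewrite (ae_eq_integral (cst 0%E)) ?integral0//.
  - exact: (measurable_funTS (mS j)).
  - apply: filterS EU => w EUw Ew /=; apply/eqP; rewrite eq_le S_ge0 andbT.
    by apply: ge_ereal_sup => _ [m jm <-]; rewrite (EUw j m).
move/(ae_eq_integral_abs P mE (measurable_funTS (mWT j))).
by apply: filterS => w.
Qed.

Let hat i := sigma_hat kappa U C i.

Let hat_dstopping i : dstopping_time G (hat i).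
Proof.
move=> k; pose B j := if (i <= j <= k)%N then Hs j else set0.
rewrite (_ : [set _ | _] = \bigcup_j B j).
  apply: sigma_algebra_bigcupT => // j; rewrite /B.
  case: ifP => [/andP[_ jk]|_]; last by case: (sG k).
  exact: (filtration_le GS jk).
apply/seteqP; split=> w /=.
  move/inf_enat_leP => [j [ij Hj] jk]; exists j => //.
  by rewrite /B ij jk.
move=> [j _]; rewrite /B; case: ifP => // /andP[ij jk] Hj.
by apply/inf_enat_leP; exists j.
Qed.

(** At any [n >= i] for which [E n] occurs, [W n] is 0, hence at most [U n], and the rule has
    stopped by [n]. *)
Let hat_fin : {ae P, forall w, forall i,
  exists2 k, hat i w = Some k & (i <= k)%N}.
Proof.
apply: filterS3 W_eq0 Ytilde_ae Eev => w Ww YW Ew i.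
have [n iln /Ww Wn] := Ew i.
have : le_enat (hat i w) (Some n).
  apply/inf_enat_leP; exists n => //; split => //.
  by rewrite -YW Wn lee_fin.
case hi : (hat i w) => [k|//] _; exists k => //.
have : le_enat (hat i w) (Some k) by rewrite hi /= leqnn.
move=> /inf_enat_leP[j [ij Hj] jk]; exact: (leq_trans ij jk).
Qed.

Let mXhat i : measurable_fun setT (EFin \o at_enat U (hat i)).
Proof. by apply/measurable_EFinP; apply: (measurable_at_enat sG Gm GS). Qed.

Let Xhat0 i w : (0 <= (EFin \o at_enat U (hat i)) w)%E.
Proof. by rewrite lee_fin at_enat_ge0. Qed.

(* [Q m] is the event that the rule [hat i] does not stop before [i + m]. *)
Let intW_hat i A m : G i A ->
  (\int[P]_(w in A) W i w <=
   \int[P]_(w in A) (at_enat U (hat i) w)%:E + \int[P]_w S (i + m)%N w)%E.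
Proof.
move=> GA; have mA := Gm GA.
pose Q m := iteri m (fun k B => B `\` Hs (i + k)%N) [set: Omega].
have GQ n : G (i + n)%N (Q n).
  elim: n => [|n ih]; first exact: (sigma_algebraT (sG _)).
  by rewrite addnS; apply: GS; exact: sigma_algebraD.
have GAn n : G (i + n)%N A by apply: (filtration_le GS _ GA); exact: leq_addr.
have Q_not n w : Q n w -> forall j, (i <= j < i + n)%N -> ~ Hs j w.
  elim: n => [_ j|n ih]; first by rewrite addn0 ltnNge => /andP[->].
  move=> [/ih Qw nH] j; rewrite addnS ltnS => /andP[ij].
  by rewrite leq_eqVlt => /predU1P[->//|jn]; apply: Qw; rewrite ij.
have hatQ n w : Q n w -> Hs (i + n)%N w -> hat i w = Some (i + n)%N.
  move=> Qw Hw; apply: inf_enat_SomeP; first by split=> //; exact: leq_addr.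
  by move=> j jn [/= ij Hj]; apply: (Q_not n w Qw j) => //; rewrite ij.
(* From [n] to [n + 1], split [Q n] along [Hs (i + n)]: on this event the rule stops at [i + n] and
   [W] is at most the stopped payoff; off it [intW_step] applies. *)
have main n : (\int[P]_(w in A) W i w <=
    \int[P]_(w in A `\` Q n) (EFin \o at_enat U (hat i)) w +
    \int[P]_(w in A `&` Q n) W (i + n)%N w)%E.
  elim: n => [|n ih]; first by rewrite setDT integral_set0 add0e setIT addn0.
  apply: (le_trans ih).
  pose B := A `&` Q n.
  have GB : G (i + n)%N B by exact: sigma_algebraI.
  have mB := Gm GB; have mH := Gm (@GHs (i + n)%N).
  have mQ := Gm (GQ n); have mQ' := Gm (GQ n.+1).
  have mD : measurable (A `\` Q n.+1) by exact: measurableD.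
  rewrite (ge0_integral_setID P mB mH (mWT _))//.
  rewrite (ge0_integral_setID P mD mQ (mXhat i))//.
  have -> : (A `\` Q n.+1) `&` Q n = B `&` Hs (i + n)%N.
    apply/seteqP; split=> w /=.
      by move=> [[Aw nQ] Qw]; split=> //; apply: contrapT => nH; apply: nQ.
    by move=> [[Aw Qw] Hw]; split=> //; split=> // -[_].
  have -> : (A `\` Q n.+1) `\` Q n = A `\` Q n.
    apply/seteqP; split=> w /=; first by move=> [[]].
    by move=> [Aw nQ]; split=> //; split=> // -[].
  have -> : A `&` Q n.+1 = B `\` Hs (i + n)%N by rewrite /= setDE setIA -setDE.
  rewrite addeA; apply: leeD.
    rewrite addeC; apply: leeD => //.
    have mBH : measurable (B `&` Hs (i + n)%N) by exact: measurableI.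
    apply: ae_ge0_le_integral => //.
    - exact: (measurable_funTS (mWT _)).
    - exact: (measurable_funTS (mXhat i)).
    apply: filterS Ytilde_ae => w /(_ (i + n)%N) YW [[_ Qw] Hw].
    by rewrite YW /= /at_enat (hatQ n).
  rewrite addnS; apply: intW_step; first exact: sigma_algebraD.
  by move=> w [].
(* Enlarge the stopped part to all of [A], and bound the part not yet stopped by the whole integral
   of [S (i + m)]. *)
apply: (le_trans (main m)); apply: leeD.
  apply: ge0_subset_integral => //.
  - by apply: measurableD => //; exact: Gm (GQ m).
  - exact: (measurable_funTS (mXhat i)).
have mAQ : measurable (A `&` Q m) by apply: measurableI => //; exact: Gm (GQ m).
apply: (@le_trans _ _ (\int[P]_(w in A `&` Q m) S (i + m)%N w)%E).
  by apply: intW_le; exact: sigma_algebraI.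
by apply: ge0_subset_integral.
Qed.

Variable Yhat : nat -> Omega -> R.
Hypothesis hYhat : forall i, is_cond_exp P (G i) (at_enat U (hat i)) (Yhat i).

(** Let [m] tend to infinity in [intW_hat]; the error term tends to 0 by [intS_cvg]. *)
Let W_le_Yhat i : {ae P, forall w, (W i w <= (Yhat i w)%:E)%E}.
Proof.
have [mY iY XY] := hYhat i.
apply: (ae_le_of_integral (sG i) (@Gm i)) => //; first exact: sub_measurable_EFin.
move=> A GA; rewrite XY//; set x := (\int[P]_(w in A) _)%E.
have : (x + \int[P]_w S (i + m)%N w)%E @[m --> \oo] --> (x + 0)%E.
  have xfin : x \is a fin_num.
    rewrite /x -XY//; apply: integrable_fin_num; first exact: Gm GA.
    by apply: integrableS iY => //; exact: Gm GA.
  apply: cvgeD; first exact: fin_num_adde_defr.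
  - exact: cvg_cst.
  - under eq_fun do rewrite addnC.
    by have := intS_cvg; rewrite -(cvg_shiftn i).
rewrite adde0 => /cvge_to_ge; apply; apply: nearW => m; exact: intW_hat.
Qed.

Variable Ysigma : nat -> Omega -> R.
Hypothesis hYsigma : forall i,
  is_cond_exp P (G i) (at_enat U (sigma i)) (Ysigma i).
Variable Y : nat -> Omega -> \bar R.
Hypothesis hY : is_snell_envelope P G U Y.

Let Yhat_le i : {ae P, forall w, ((Yhat i w)%:E <= Y i w)%E}.
Proof.
have [_ + _] := hY i; apply.
(* The Snell envelope ranges over finite-valued times, so the value infinity of [hat i], taken on a
   null set only, is replaced by [i]. The result is still a stopping time because each [G k]
   contains the null sets. *)
pose n w := odflt i (hat i w).
have hatn : {ae P, forall w, hat i w = Some (n w)}.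
  by apply: filterS hat_fin => w /(_ i)[k hk _]; rewrite /n hk.
have nG : dstopping_time G (fun w => Some (n w)).
  move=> k; apply: (sigma_algebra_ae (sG k) (@G0 k) _ (@hat_dstopping i k)).
  by apply: filterS hatn => w /= ->.
exists n; split => //.
  by apply: filterS hat_fin => w /(_ i)[k hk ik]; rewrite /n hk.
have [mY iY XY] := hYhat i; split => // A GA; rewrite XY//.
have mA := Gm GA.
apply: ae_eq_integral => //.
- exact: (measurable_funTS (mXhat i)).
- apply: measurable_funTS; apply/measurable_EFinP.
  exact: (measurable_at_enat sG Gm GS mU nG).
- by apply: filterS hatn => w hw _; rewrite /at_enat hw.
Qed.

Lemma consistent_improvement i : {ae P, forall w,
  [/\ ((Ysigma i w)%:E <= Ytilde kappa C i w)%E,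
      (Ytilde kappa C i w <= (Yhat i w)%:E)%E &
      ((Yhat i w)%:E <= Y i w)%E]}.
Proof.
(* [Ysigma i] is almost surely the term [k = i] of the window. *)
have YC := cond_exp_unique (hYsigma i) (hC (leqnn i)).
apply: filterS3 YC Ytilde_ae (filterI (W_le_Yhat i) (Yhat_le i)).
move=> w YCw YW [WY YY]; split=> //; last by rewrite -YW.
by rewrite YCw -YW; exact: pos_sup_ge.
Qed.

End consistent_family.

(** * The stopped sigma-algebra and the process at a stopping time *)

Section stopped_process.
Context (R : realType) d (Omega : measurableType d) (P : probability Omega R).
Variable F : \bar R -> set (set Omega).
Hypothesis hF : filtration F.
Hypothesis hFusual : usual_conditions P F.

Let sF t : (0 <= t)%E -> sigma_algebra setT (F t).
Proof. by case: hF => h _ /h[]. Qed.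

Let Fm t : (0 <= t)%E -> F t `<=` measurable.
Proof. by case: hF => h _ /h[]. Qed.

Let F_le s t : (0 <= s)%E -> (s <= t)%E -> F s `<=` F t.
Proof. by case: hF => _; apply. Qed.

Let F0 t N : (0 <= t)%E -> P.-negligible N -> F t N.
Proof. by move=> t0 PN; apply: (F_le _ t0) => //; case: hFusual => + _; apply. Qed.

Variable tau : Omega -> \bar R.
Hypothesis htau : stopping_time F tau.

Let tau0 w : (0 <= tau w)%E.
Proof. by case: htau. Qed.

Let Ftau t : (0 <= t)%E -> F t [set w | (tau w <= t)%E].
Proof. by case: htau => _; apply. Qed.

Let Ftau_le s t : (0 <= s)%E -> (s <= t)%E -> F t [set w | (tau w <= s)%E].
Proof. by move=> s0 st; exact: (F_le s0 st (Ftau s0)). Qed.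

Lemma stopped_sigma_algebraP : sigma_algebra setT (stopped_sigma_algebra F tau).
Proof.
split=> [t t0|A FA t t0|A FA t t0].
- by rewrite set0I; case: (sF t0).
- rewrite (_ : _ `&` _ = [set w | (tau w <= t)%E] `\`
                         (A `&` [set w | (tau w <= t)%E])).
    by apply: sigma_algebraD; [exact: sF|exact: Ftau|exact: FA].
  apply/seteqP; split=> w /=; first by move=> [[_ nA] tw]; split=> // -[].
  by move=> [tw nA]; split=> //; split=> // Aw; apply: nA.
- rewrite setI_bigcupl; apply: sigma_algebra_bigcupT => [|k]; first exact: sF.
  exact: FA.
Qed.

Lemma stopped_sigma_algebra_sub : stopped_sigma_algebra F tau `<=` measurable.
Proof.
move=> A /(_ +oo%E (leey _)); rewrite (_ : _ `&` _ = A).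
  exact: Fm (leey _) A.
by apply/seteqP; split=> w /=; [case|split=> //; exact: leey].
Qed.

Lemma stopped_sigma_algebra_negligible N :
  P.-negligible N -> stopped_sigma_algebra F tau N.
Proof. by move=> PN t t0; apply: F0 => //; apply: negligibleS PN => w []. Qed.

Lemma stopped_sigma_algebra_gt (r : R) :
  0 <= r -> stopped_sigma_algebra F tau [set w | (r%:E < tau w)%E].
Proof.
move=> r0 t t0; pose s := mine r%:E t.
have s0 : (0 <= s)%E by rewrite le_min lee_fin r0.
rewrite (_ : _ `&` _ = [set w | (tau w <= t)%E] `\` [set w | (tau w <= s)%E]).
  apply: sigma_algebraD; [exact: sF|exact: Ftau|apply: Ftau_le => //].
  by rewrite ge_min lexx orbT.
apply/seteqP; split=> w /=.
  move=> [rt tt]; split=> //; rewrite le_min tt andbT.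
  by apply/negP; rewrite -ltNge.
by move=> [tt /negP]; rewrite le_min tt andbT -ltNge.
Qed.

Variables (Z : R -> Omega -> R) (T : R).
Hypothesis T0 : 0 <= T.
Hypothesis hZ_adapted : adapted F Z.
Hypothesis hZ_cadlag : forall w, cadlag_on T (fun t => Z t w).
Hypothesis hZ_after : {ae P, forall w, forall t, T < t -> Z t w = 0}.

(* [tau] is approximated by grid points strictly above it, capped at [t]; where
   [tau = t] the capped approximation is constant. *)
Lemma measurable_at_time_le (t : R) : 0 <= t -> t <= T ->
  measurable_fun
    ([set w | (tau w <= t%:E)%E] : set (g_sigma_algebraType (F t%:E)))
    (at_time Z tau : g_sigma_algebraType (F t%:E) -> R).
Proof.
move=> t0 tT; have tE0 : (0 <= t%:E)%E by rewrite lee_fin.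
have sFt := sF tE0.
pose A n w := [set k | (tau w <= (k%:R / n.+1%:R)%:E)%E].
pose kn n w := odflt 0%N (inf_enat (A n w)).
(* [kn] is the first grid index at or above [tau]. Taking its successor here puts the grid point
   strictly above [tau], as convergence from the right requires. *)
pose s (n k : nat) : R := Num.min t (k.+1%:R / n.+1%:R).
have s0 n k : 0 <= s n k by rewrite le_min t0/= divr_ge0.
have knE n w k : A n w k -> (forall j, (j < k)%N -> ~ A n w j) -> kn n w = k.
  by move=> Ak kmin; rewrite /kn (inf_enat_SomeP Ak).
pose D := [set w | (tau w <= t%:E)%E] : set Omega.
pose c n k := [set w | (tau w <= (Num.min t (k%:R / n.+1%:R))%:E)%E].
have cP n k w : D w -> c n k w <-> A n w k.
  by move=> Dw; rewrite /c /A /= EFin_min le_min Dw.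
have AD n w : D w -> exists2 k, A n w k & forall j, (j < k)%N -> ~ A n w j.
  move=> Dw; have [k Ak] : exists k, A n w k.
    exists (Num.bound (t * n.+1%:R)); apply: (le_trans Dw).
    rewrite lee_fin ler_pdivlMr// ltW// archi_boundP//.
    by rewrite mulr_ge0.
  have ex : exists k, `[< A n w k >] by exists k; exact/asboolP.
  case: (ex_minnP ex) => m /asboolP Am mmin; exists m => // j jm /asboolP/mmin.
  by rewrite leqNgt jm.
apply: (@measurable_fun_cvg _ (g_sigma_algebraType (F t%:E)) R _
  (fun n w => Z (s n (kn n w)) w)).
- move=> n.
  (* On the [k]-th disjoint piece [kn n] equals [k], so the approximation is [Z (s n k)], known at
     time [s n k <= t]. *)
  have -> : [set w | (tau w <= t%:E)%E] = \bigcup_k seqDU (c n) k.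
    rewrite -seqDU_bigcup_eq; apply/seteqP; split=> w /=.
      by move=> Dw; have [k Ak _] := AD n w Dw; exists k => //; exact/cP.
    move=> [k _]; rewrite /c /= EFin_min => h; apply: (le_trans h).
    by rewrite ge_min lexx.
  have mc k : measurable (c n k : set (g_sigma_algebraType (F t%:E))).
    rewrite g_measurableE//; apply: Ftau_le.
      by rewrite lee_fin le_min t0/= divr_ge0.
    by rewrite lee_fin ge_min lexx.
  have mcD := seqDU_measurable mc.
  apply/measurable_fun_bigcup => // k.
  apply: (eq_measurable_fun (Z (s n k) : g_sigma_algebraType (F t%:E) -> R)).
    move=> w; rewrite inE => -[ck ncj]; congr (Z (s n _) w); apply/esym.
    have Dw : D w.
      move: ck; rewrite /c /= EFin_min => h; apply: (le_trans h).
      by rewrite ge_min lexx.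
    apply: knE; first exact/cP.
    move=> j jk /(cP _ _ _ Dw) cj; apply: ncj; rewrite -bigcup_mkord.
    by exists j.
  apply: measurable_funTS => /= mT B mB.
  rewrite setTI g_measurableE//; apply: (@F_le (s n k)%:E).
  - by rewrite lee_fin.
  - by rewrite lee_fin ge_min lexx.
  - have sE0 : (0 <= (s n k)%:E)%E by rewrite lee_fin.
    by have /(sub_measurableP (sF sE0)) := hZ_adapted (s0 n k); apply.
- move=> w Dw; have [r rE] : exists r, tau w = r%:E.
    by move: (tau0 w) Dw; rewrite /=; case: (tau w) => [r _ _||] //; exists r.
  have r0 : 0 <= r by rewrite -lee_fin -rE.
  have rt : r <= t by rewrite -lee_fin -rE.
  have kn_ge n : r * n.+1%:R <= (kn n w)%:R.
    have [k Ak kmin] := AD n w Dw; rewrite (knE _ _ _ Ak kmin).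
    by move: Ak; rewrite /A /= rE lee_fin ler_pdivlMr.
  have kn_le n : (kn n w)%:R <= r * n.+1%:R + 1.
    have [k Ak kmin] := AD n w Dw; rewrite (knE _ _ _ Ak kmin).
    case: k kmin {Ak} => [_|k kmin]; first by rewrite addr_ge0// mulr_ge0.
    rewrite -natr1 lerD2r; have := kmin k (ltnSn k).
    by move=> /negP; rewrite /A /= rE lee_fin ler_pdivlMr// -ltNge => /ltW.
  rewrite /at_time rE.
  have [rt1|rt'] := eqVneq r t; first rewrite rt1.
    have -> : (fun n => Z (s n (kn n w)) w) = cst (Z t w); last exact: cvg_cst.
    apply/funext => n; rewrite /s; congr (Z _ w); apply/min_idPl.
    by rewrite ler_pdivlMr// -[leRHS]natr1 -rt1 (le_trans (kn_ge n))// lerDl.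
  have {rt'} rt' : r < t by rewrite lt_neqAle rt' rt.
  have [rc _] := hZ_cadlag w.
  have /rc/cvg_at_rightP : 0 <= r < T by rewrite r0 (lt_le_trans rt').
  apply; split.
    move=> n; rewrite lt_min rt' ltr_pdivlMr// -[ltRHS]natr1.
    by rewrite (le_lt_trans (kn_ge n))// ltrDl.
  (* The factor 2 adds the rounding up to the grid and the shift to the next grid point. *)
  apply: (@squeeze_cvgr _ _ _ _ (cst r) (fun n => r + 2 * harmonic n)).
  + apply: nearW => n; apply/andP; split.
      by rewrite /= le_min rt ler_pdivlMr// -[leRHS]natr1 (le_trans (kn_ge n))// lerDl.
    rewrite ge_min; apply/orP; right; rewrite ler_pdivrMr// mulrDl /harmonic /=.
    rewrite -mulrA mulVf// mulr1 -[leLHS]natr1 (_ : 2 = 1 + 1)// addrA lerD2r.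
    exact: kn_le.
  + exact: cvg_cst.
  + rewrite -[X in _ --> X]addr0 -[X in _ + X](mulr0 2).
    by apply: cvgD; [exact: cvg_cst|apply: cvgMr; exact: cvg_harmonic].
Qed.

(** Times up to [T] are handled by path regularity, later ones by the vanishing of [Z]. *)
Lemma sub_measurable_at_time :
  sub_measurable (stopped_sigma_algebra F tau) (at_time Z tau).
Proof.
apply/(sub_measurableP stopped_sigma_algebraP) => B mB t t0.
have small (r : R) : 0 <= r -> r <= T ->
    F r%:E (at_time Z tau @^-1` B `&` [set w | (tau w <= r%:E)%E]).
  move=> r0 rT; have rE0 : (0 <= r%:E)%E by rewrite lee_fin.
  rewrite setIC -g_measurableE; last exact: sF.
  apply: measurable_at_time_le => //.
  by rewrite g_measurableE; [exact: Ftau|exact: sF].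
have [tT|Tt] := leP t T%:E.
  by case: t t0 tT => [r||]//; rewrite !lee_fin => r0 rT; exact: small.
have TE0 : (0 <= T%:E)%E by rewrite lee_fin.
pose D := [set w | (tau w <= t)%E] `\` [set w | (tau w <= T%:E)%E].
have FD : F t D.
  apply: sigma_algebraD; [exact: sF|exact: Ftau|].
  by apply: Ftau_le => //; exact: ltW.
have -> : at_time Z tau @^-1` B `&` [set w | (tau w <= t)%E] =
    (at_time Z tau @^-1` B `&` [set w | (tau w <= T%:E)%E]) `|`
    (at_time Z tau @^-1` B `&` D).
  rewrite -setIUr setDUK//= => w /= /le_trans; apply; exact: ltW.
apply: sigma_algebraU; [exact: sF|by apply: (F_le TE0 (ltW Tt)); exact: small|].
(* On [D] the stopped value is almost surely 0, also where [tau] is infinite; so up to a null set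
   the preimage meets [D] in all of it or in nothing, according to whether [B] contains 0. *)
apply: (@sigma_algebra_ae _ _ _ P (F t) (sF t0) (fun N => @F0 t N t0)
  (if `[< B 0 >] then D else set0)).
  apply: filterS hZ_after => w Zw.
  have at0 : D w -> at_time Z tau w = 0.
    move=> [_ /negP]; rewrite -ltNge /at_time.
    by case: (tau w) => [r||]//; rewrite lte_fin => /Zw.
  case: asboolP => B0; split=> //=.
  - by move=> Dw; split=> //; rewrite at0.
  - by case.
  - by move=> [+ Dw]; rewrite at0.
by case: asboolP => // _; case: (sF t0).
Qed.

End stopped_process.

(** Intersecting [A] with both events [tau <= t] and [tau' <= t] changes [A] on [tau' <= t] only by
    a null set, which [F t] contains. *)
Lemma stopped_sigma_algebra_le (R : realType) d (Omega : measurableType d)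
    (P : probability Omega R) (F : \bar R -> set (set Omega))
    (tau tau' : Omega -> \bar R) :
  filtration F -> usual_conditions P F ->
  stopping_time F tau' -> {ae P, forall w, (tau w <= tau' w)%E} ->
  stopped_sigma_algebra F tau `<=` stopped_sigma_algebra F tau'.
Proof.
move=> [hF F_le] [F0 _] [_ Ftau'] tt' A FA t t0.
have [sF _] := hF t t0.
have F0t N : P.-negligible N -> F t N by move=> /F0; exact: F_le.
apply: (sigma_algebra_ae sF F0t _ (sigma_algebraI sF (FA t t0) (Ftau' t t0))).
apply: filterS tt' => w ttw; split=> /=; first by move=> [[]].
by move=> [Aw tw]; split=> //; split=> //; exact: le_trans ttw tw.
Qed.

(** * Reduction of the continuous-time setting to discrete time *)

Theorem proposition8 (R : realType) (d : measure_display)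
    (Omega : measurableType d) (P : probability Omega R)
    (F : \bar R -> set (set Omega))
    (hF : filtration F) (hFusual : usual_conditions P F)
    (tau : nat -> Omega -> \bar R)
    (htau : forall i, stopping_time F (tau i))
    (htau0 : {ae P, forall w, tau 0%N w = 0%E})
    (htau_lt : {ae P, forall w, forall i, (tau i w < tau i.+1 w < +oo)%E})
    (htau_lim : {ae P, forall w, tau i w @[i --> \oo] --> +oo%E})
    (T : R) (hT : 0 < T)
    (Z : R -> Omega -> R)
    (hZ_ge0 : forall t w, 0 <= t -> 0 <= Z t w)
    (hZ_adapted : adapted F Z)
    (hZ_cadlag : forall w, cadlag_on T (fun t => Z t w))
    (hZ_after : {ae P, forall w, forall t, T < t -> Z t w = 0})
    (B alpha : R) (hB : 0 < B) (halpha : 1 < alpha)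
    (U : nat -> Omega -> R)
    (hU : forall i, U i = at_time Z (tau i))
    (hUint : (\int[P]_w ereal_sup (range (fun i => (U i w `^ alpha)%:E))
                <= (B `^ alpha)%:E)%E)
    (G : nat -> set (set Omega))
    (hG : forall i, G i = stopped_sigma_algebra F (tau i))
    (sigma : nat -> Omega -> enat)
    (hsigma : stopping_family P G sigma)
    (hconsistent : consistent P sigma)
    (kappa : enat) (hkappa : le_enat (Some 1%N) kappa)
    (C : nat -> nat -> Omega -> R)
    (hC : forall j k, (j <= k)%N ->
       is_cond_exp P (G j) (at_enat U (sigma k)) (C j k))
    (Ysigma : nat -> Omega -> R)
    (hYsigma : forall i, is_cond_exp P (G i) (at_enat U (sigma i)) (Ysigma i))
    (Yhat : nat -> Omega -> R)
    (hYhat : forall i,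
       is_cond_exp P (G i) (at_enat U (sigma_hat kappa U C i)) (Yhat i))
    (Y : nat -> Omega -> \bar R)
    (hY : is_snell_envelope P G U Y) :
  forall i, {ae P, forall w,
    [/\ ((Ysigma i w)%:E <= Ytilde kappa C i w)%E,
        (Ytilde kappa C i w <= (Yhat i w)%:E)%E &
        ((Yhat i w)%:E <= Y i w)%E]}.
Proof.
have GsA i : sigma_algebra setT (G i).
  by rewrite hG; exact: stopped_sigma_algebraP.
have Gm i : G i `<=` measurable.
  by rewrite hG; exact: stopped_sigma_algebra_sub.
have GS i : G i `<=` G i.+1.
  rewrite !hG; apply: (stopped_sigma_algebra_le hF hFusual) => //.
  by apply: filterS htau_lt => w /(_ i)/andP[/ltW].
have G0 i N : P.-negligible N -> G i N.
  by rewrite hG; exact: stopped_sigma_algebra_negligible.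
have U0 i w : 0 <= U i w.
  rewrite hU /at_time; have [/(_ w) + _] := htau i.
  by case: (tau i w) => // r; rewrite lee_fin; exact: hZ_ge0.
have mU i : sub_measurable (G i) (U i).
  rewrite hG hU; exact: (sub_measurable_at_time hF hFusual _ (ltW hT)).
have mUT i : measurable_fun setT (U i).
  exact: (sub_measurable_measurable (GsA i) (@Gm i)).
(* [x <= 1 + x ^ alpha] for [x >= 0]. *)
have US : (\int[P]_w ereal_sup (range (fun m => (U m w)%:E)) < +oo)%E.
  have mUa : measurable_fun setT
      (fun w => ereal_sup (range (fun i => (U i w `^ alpha)%:E))).
    apply: measurable_ereal_sup_range => i; apply/measurable_EFinP.
    by apply: (measurableT_comp (measurable_powR alpha)); exact: mUT.
  have Ua0 w : (0 <= ereal_sup (range (fun i => (U i w `^ alpha)%:E)))%E.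
    apply: (@le_trans _ _ (U 0%N w `^ alpha)%:E); first by rewrite lee_fin powR_ge0.
    by apply: ereal_sup_ubound; exists 0%N.
  apply: (@le_lt_trans _ _ (\int[P]_w
      (1 + ereal_sup (range (fun i => (U i w `^ alpha)%:E))))%E); last first.
    rewrite ge0_integralD// integral_cst// mul1e; apply: lte_add_pinfty.
      by rewrite (le_lt_trans (probability_le1 P measurableT))// ltry.
    exact: (le_lt_trans hUint (ltry _)).
  apply: ge0_le_integral => //.
  - move=> w _; apply: (@le_trans _ _ (U 0%N w)%:E); first by rewrite lee_fin.
    by apply: ereal_sup_ubound; exists 0%N.
  - by apply: measurable_ereal_sup_range => i; exact/measurable_EFinP.
  - exact: emeasurable_funD.
  move=> w _; apply: ge_ereal_sup => _ [i _ <-].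
  apply: (@le_trans _ _ (1 + (U i w `^ alpha)%:E)%E).
    rewrite -EFinD lee_fin; have [U1|/ltW U1] := leP (U i w) 1.
      by rewrite (le_trans U1)// lerDl powR_ge0.
    rewrite -[leLHS]powRr1// (@le_trans _ _ (U i w `^ alpha))//.
      by apply: ler_powR => //; exact: ltW.
    by rewrite lerDr.
  by apply: leeD => //; apply: ereal_sup_ubound; exists i.
(* These events play the role of [E]: almost surely they persist because the times increase, and
   they occur eventually because the times tend to infinity. *)
have GE i : G i [set w | (T%:E < tau i w)%E].
  by rewrite hG; apply: stopped_sigma_algebra_gt => //; exact: ltW.
have EU : {ae P, forall w, forall n m,
    (T%:E < tau n w)%E -> (n <= m)%N -> U m w = 0}.
  apply: filterS2 htau_lt hZ_after => w tw Zw n m Tn nm.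
  have : (T%:E < tau m w)%E.
    rewrite -(subnKC nm); elim: (m - n)%N => [|k ih]; first by rewrite addn0.
    by rewrite addnS (lt_trans ih)//; case/andP: (tw (n + k)%N).
  rewrite hU /at_time; case: (tau m w) => [r||]//.
  by rewrite lte_fin; exact: Zw.
have Eev : {ae P, forall w, forall i,
    exists2 n, (i <= n)%N & (T%:E < tau n w)%E}.
  apply: filterS htau_lim => w /cvgey_gt/(_ T)[n _ Tn] i.
  by exists (maxn i n); [exact: leq_maxl|apply: Tn; exact: leq_maxr].
by apply: (consistent_improvement GsA Gm GS G0 U0 mU US GE EU Eev
  hsigma hconsistent hkappa hC hYhat hYsigma hY).
Qed.
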